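(* For every sequence of positive real numbers $(\varepsilon_n)_{n=1}^\infty$ such that $\lim_{n\to\infty} n\varepsilon_n=\infty$, there exists a $(1+\varepsilon_n)$-bounded M-basis $\{x_n,x_n^*\}_{n\in\mathbb{N}}$ of $\ell_2$ such that none of its permutations is equivalent to a Schauder basis of $\ell_2$; that is, for every permutation (bijection) $\sigma:\mathbb{N}\to\mathbb{N}$, the sequence $(x_{\sigma(n)})_{n\in\mathbb{N}}$ is not equivalent to any Schauder basis of $\ell_2$.
   Context: Let $X$ be a Banach space with dual $X^*$. A Markushevich basis (M-basis) of $X$ is a biorthogonal sequence $\{x_n,x_n^*\}_{n\in\mathbb{N}}$ in $X\times X^*$ (that is, $x_n^*(x_m)=1$ if $n=m$ and $0$ otherwise) such that $\{x_n\}$ is fundamental (the linear span of $\{x_n\}$ is norm dense in $X$) and $\{x_n^*\}$ is total (if $x\in X$ and $x_n^*(x)=0$ for all $n$, then $x=0$). Given a sequence of nonnegative numbers $(\varepsilon_n)$, an M-basis is called $(1+\varepsilon_n)$-bounded if $\|x_n\|\cdot\|x_n^*\|\le 1+\varepsilon_n$ for all $n\in\mathbb{N}$. A set of vectors $\{x_n\}_n$ in $X$ is called minimal if there exist functionals $\{x_n^*\}_n\subset X^*$ such that $\{x_n,x_n^*\}_n$ is biorthogonal. Two minimal systems $\{x_n\}_n$ and $\{y_n\}_n$ are called equivalent if the linear map $A$ defined by $Ax_n=y_n$ for all $n$ is (extends to) a bounded isomorphism of $\overline{\operatorname{span}}\{x_n\}_n$ onto $\overline{\operatorname{span}}\{y_n\}_n$,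 i.e. $\|A\|\cdot\|A^{-1}\|<\infty$. A Schauder basis of $X$ is a sequence $(y_n)_{n\in\mathbb{N}}$ in $X$ such that every $x\in X$ has a unique representation $x=\sum_{n=1}^\infty a_n y_n$ as a norm-convergent series with scalar coefficients. *)

(* Defs.v *)
From Stdlib Require Import Reals Lra Psatz FunctionalExtensionality ProofIrrelevance.
From Stdlib Require Export FinFun.
From Coquelicot Require Export Coquelicot.

Open Scope R_scope.

(** The construction makes sense over any ring with an absolute value; the
    scalar fields of interest are [R_AbsRing] and [C_AbsRing]. *)
Record ell2 (K : AbsRing) : Type := Ell2 {
  coef : nat -> K;
  coef_summable : ex_series (fun n => abs (coef n) ^ 2)
}.
Arguments Ell2 {K} coef coef_summable.
Arguments coef {K} _ _.
Arguments coef_summable {K} _.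

Section Ell2.

Context {K : AbsRing}.
Implicit Types u v w : ell2 K.

Lemma ell2_eq u v : (forall n, coef u n = coef v n) -> u = v.
Proof.
destruct u as [a ha]; destruct v as [b hb]; simpl; intros h.
assert (e : a = b) by (apply functional_extensionality; exact h).
subst b; f_equal; apply proof_irrelevance.
Qed.

Lemma sq_abs_pos (a : K) : 0 <= abs a ^ 2.
Proof. apply pow2_ge_0. Qed.

Lemma sq_abs_plus_le (a b : K) (t : R) : 0 < t ->
  abs (plus a b) ^ 2 <= (1 + t) * abs a ^ 2 + (1 + / t) * abs b ^ 2.
Proof.
intros ht.
apply Rle_trans with ((abs a + abs b) ^ 2).
  apply pow_incr; split; [apply abs_ge_0 | apply abs_triangle].
assert (h : 0 <= / t * (t * abs a - abs b) ^ 2).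
  apply Rmult_le_pos; [left; now apply Rinv_0_lt_compat | apply pow2_ge_0].
replace ((1 + t) * abs a ^ 2 + (1 + / t) * abs b ^ 2)
  with ((abs a + abs b) ^ 2 + / t * (t * abs a - abs b) ^ 2) by (field; lra).
lra.
Qed.

Lemma ex_series_young (a b : nat -> R) (s t : R) :
  ex_series a -> ex_series b -> ex_series (fun n => s * a n + t * b n).
Proof.
intros ha hb.
apply (ex_series_plus (fun n => s * a n) (fun n => t * b n)).
  exact (ex_series_scal_l s a ha).
exact (ex_series_scal_l t b hb).
Qed.

Lemma plus_summable (a b : nat -> K) :
  ex_series (fun n => abs (a n) ^ 2) -> ex_series (fun n => abs (b n) ^ 2) ->
  ex_series (fun n => abs (plus (a n) (b n)) ^ 2).
Proof.
intros ha hb.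
apply (ex_series_le (K := R_AbsRing) (V := R_CompleteNormedModule) _
  (fun n => (1 + 1) * abs (a n) ^ 2 + (1 + / 1) * abs (b n) ^ 2)).
  intros n; change norm with Rabs; rewrite Rabs_pos_eq.
    apply sq_abs_plus_le; lra.
  apply sq_abs_pos.
now apply ex_series_young.
Qed.

Lemma sq_abs_scal_le (k a : K) : abs (mult k a) ^ 2 <= abs k ^ 2 * abs a ^ 2.
Proof.
rewrite <- Rpow_mult_distr.
apply pow_incr; split; [apply abs_ge_0 | apply abs_mult].
Qed.

Lemma scal_summable (k : K) (a : nat -> K) :
  ex_series (fun n => abs (a n) ^ 2) ->
  ex_series (fun n => abs (mult k (a n)) ^ 2).
Proof.
intros ha.
apply (ex_series_le (K := R_AbsRing) (V := R_CompleteNormedModule) _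
  (fun n => abs k ^ 2 * abs (a n) ^ 2)).
  intros n; change norm with Rabs; rewrite Rabs_pos_eq.
    apply sq_abs_scal_le.
  apply sq_abs_pos.
exact (ex_series_scal_l (abs k ^ 2) _ ha).
Qed.

Lemma opp_summable (a : nat -> K) :
  ex_series (fun n => abs (a n) ^ 2) -> ex_series (fun n => abs (opp (a n)) ^ 2).
Proof.
apply ex_series_ext; intros n; now rewrite abs_opp.
Qed.

Lemma zero_summable : ex_series (fun _ : nat => abs (zero : K) ^ 2).
Proof.
exists 0; apply is_series_ext with (fun _ => 0).
  intros _; rewrite abs_zero; simpl; ring.
apply (filterlim_ext (fun _ => 0)).
  intros n; symmetry; rewrite sum_n_const; ring.
apply filterlim_const.
Qed.

Definition ell2_plus u v : ell2 K :=
  Ell2 (fun n => plus (coef u n) (coef v n))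
    (plus_summable _ _ (coef_summable u) (coef_summable v)).
Definition ell2_opp u : ell2 K :=
  Ell2 (fun n => opp (coef u n)) (opp_summable _ (coef_summable u)).
Definition ell2_zero : ell2 K := Ell2 (fun _ => zero) zero_summable.
Definition ell2_scal (k : K) u : ell2 K :=
  Ell2 (fun n => mult k (coef u n)) (scal_summable k _ (coef_summable u)).

Definition ell2_norm u : R := sqrt (Series (fun n => abs (coef u n) ^ 2)).

Definition ell2_ball u (e : R) v : Prop :=
  ell2_norm (ell2_plus v (ell2_opp u)) < e.

Lemma ell2_plus_comm u v : ell2_plus u v = ell2_plus v u.
Proof. apply ell2_eq; intros n; apply plus_comm. Qed.

Lemma ell2_plus_assoc u v w :
  ell2_plus u (ell2_plus v w) = ell2_plus (ell2_plus u v) w.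
Proof. apply ell2_eq; intros n; apply plus_assoc. Qed.

Lemma ell2_plus_zero_r u : ell2_plus u ell2_zero = u.
Proof. apply ell2_eq; intros n; exact (plus_zero_r (coef u n)). Qed.

Lemma ell2_plus_opp_r u : ell2_plus u (ell2_opp u) = ell2_zero.
Proof. apply ell2_eq; intros n; exact (plus_opp_r (coef u n)). Qed.

Lemma ell2_scal_assoc (k l : K) u :
  ell2_scal k (ell2_scal l u) = ell2_scal (mult k l) u.
Proof. apply ell2_eq; intros n; apply mult_assoc. Qed.

Lemma ell2_scal_one u : ell2_scal one u = u.
Proof. apply ell2_eq; intros n; exact (mult_one_l (coef u n)). Qed.

Lemma ell2_scal_distr_l (k : K) u v :
  ell2_scal k (ell2_plus u v) = ell2_plus (ell2_scal k u) (ell2_scal k v).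
Proof. apply ell2_eq; intros n; exact (mult_distr_l k (coef u n) (coef v n)). Qed.

Lemma ell2_scal_distr_r (k l : K) u :
  ell2_scal (plus k l) u = ell2_plus (ell2_scal k u) (ell2_scal l u).
Proof. apply ell2_eq; intros n; exact (mult_distr_r k l (coef u n)). Qed.

Lemma Series_pos (a : nat -> R) :
  (forall n, 0 <= a n) -> ex_series a -> 0 <= Series a.
Proof.
intros h ha.
replace 0 with (Series (fun n => 0 * a n)).
  apply Series_le; trivial; intros n; specialize (h n); lra.
rewrite Series_scal_l; ring.
Qed.

Lemma ell2_sq_norm_pos u : 0 <= Series (fun n => abs (coef u n) ^ 2).
Proof.
apply Series_pos; [intros n; apply sq_abs_pos | apply coef_summable].
Qed.

Lemma ell2_norm_pos u : 0 <= ell2_norm u.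
Proof. apply sqrt_pos. Qed.

Lemma ell2_norm_sq u : ell2_norm u ^ 2 = Series (fun n => abs (coef u n) ^ 2).
Proof. apply pow2_sqrt, ell2_sq_norm_pos. Qed.

Lemma ell2_norm_young u v (t : R) : 0 < t ->
  ell2_norm (ell2_plus u v) ^ 2
    <= (1 + t) * ell2_norm u ^ 2 + (1 + / t) * ell2_norm v ^ 2.
Proof.
intros ht; rewrite !ell2_norm_sq, <- !Series_scal_l, <- Series_plus.
- apply Series_le.
    intros n; split; [apply sq_abs_pos | now apply sq_abs_plus_le].
  apply ex_series_young; apply coef_summable.
- exact (ex_series_scal_l (1 + t) _ (coef_summable u)).
- exact (ex_series_scal_l (1 + / t) _ (coef_summable v)).
Qed.

Lemma ell2_norm_triangle u v :
  ell2_norm (ell2_plus u v) <= ell2_norm u + ell2_norm v.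
Proof.
set (a := ell2_norm u); set (b := ell2_norm v).
assert (ha : 0 <= a) by apply ell2_norm_pos.
assert (hb : 0 <= b) by apply ell2_norm_pos.
apply Rnot_lt_le; intros hlt.
set (c := ell2_norm (ell2_plus u v)) in *.
set (d := (c - (a + b)) / 2).
assert (hd : 0 < d) by (unfold d; lra).
assert (hy := ell2_norm_young u v ((b + d) / (a + d))).
fold a b c in hy.
assert (h0 : 0 < (b + d) / (a + d)) by (apply Rdiv_lt_0_compat; lra).
specialize (hy h0).
assert (h1 : (1 + (b + d) / (a + d)) * a ^ 2 <= a ^ 2 + a * (b + d)).
  replace (a ^ 2 + a * (b + d))
    with ((1 + (b + d) / (a + d)) * a ^ 2 + (b + d) / (a + d) * (a * d))
    by (field; lra).
  assert (0 <= (b + d) / (a + d) * (a * d)) by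
    (apply Rmult_le_pos; [lra | apply Rmult_le_pos; lra]).
  lra.
assert (h2 : (1 + / ((b + d) / (a + d))) * b ^ 2 <= b ^ 2 + b * (a + d)).
  replace (b ^ 2 + b * (a + d))
    with ((1 + / ((b + d) / (a + d))) * b ^ 2 + / ((b + d) / (a + d)) * (b * d))
    by (field; lra).
  assert (0 < / ((b + d) / (a + d))) by now apply Rinv_0_lt_compat.
  assert (0 <= / ((b + d) / (a + d)) * (b * d)) by
    (apply Rmult_le_pos; [lra | apply Rmult_le_pos; lra]).
  lra.
assert (hc : c = a + b + 2 * d) by (unfold d; lra).
assert (c ^ 2 <= (a + b) ^ 2 + d * (a + b)) by nra.
rewrite hc in H; nra.
Qed.

Lemma ell2_norm_scal (k : K) u : ell2_norm (ell2_scal k u) <= abs k * ell2_norm u.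
Proof.
assert (hk := abs_ge_0 k); assert (hu := ell2_norm_pos u).
apply Rsqr_incr_0_var; [| now apply Rmult_le_pos].
rewrite !Rsqr_pow2, Rpow_mult_distr, !ell2_norm_sq, <- Series_scal_l.
apply Series_le.
  intros n; split; [apply sq_abs_pos | apply sq_abs_scal_le].
exact (ex_series_scal_l (abs k ^ 2) _ (coef_summable u)).
Qed.

Lemma sum_n_term_le (a : nat -> R) (n : nat) :
  (forall k, 0 <= a k) -> a n <= sum_n a n.
Proof.
intros h; destruct n as [|n]; [rewrite sum_O; lra |].
rewrite sum_Sn; change plus with Rplus.
assert (0 <= sum_n a n); [| lra].
induction n as [|n IH]; [rewrite sum_O; apply h |].
rewrite sum_Sn; change plus with Rplus; specialize (h (S n)); lra.
Qed.

Lemma abs_coef_le_norm u (n : nat) : abs (coef u n) <= ell2_norm u.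
Proof.
apply Rsqr_incr_0_var; [| apply ell2_norm_pos].
rewrite !Rsqr_pow2, ell2_norm_sq.
apply Rle_trans with (sum_n (fun k => abs (coef u k) ^ 2) n).
  apply (sum_n_term_le (fun k => abs (coef u k) ^ 2)); intros k; apply sq_abs_pos.
apply (is_lim_seq_incr_compare (sum_n (fun k => abs (coef u k) ^ 2))
  (Series (fun k => abs (coef u k) ^ 2))).
  exact (Series_correct _ (coef_summable u)).
intros m; rewrite sum_Sn; change plus with Rplus.
assert (h := sq_abs_pos (coef u (S m))); lra.
Qed.

Lemma ell2_norm_eq_zero u : ell2_norm u = 0 -> u = ell2_zero.
Proof.
intros h; apply ell2_eq; intros n; apply abs_eq_zero.
apply Rle_antisym; [rewrite <- h; apply abs_coef_le_norm | apply abs_ge_0].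
Qed.

Lemma ell2_norm_opp u : ell2_norm (ell2_opp u) = ell2_norm u.
Proof.
unfold ell2_norm; f_equal; apply Series_ext; intros n; simpl coef.
now rewrite abs_opp.
Qed.

Lemma ell2_norm_zero : ell2_norm ell2_zero = 0.
Proof.
apply Rle_antisym; [| apply ell2_norm_pos].
rewrite <- (ell2_plus_opp_r ell2_zero).
replace (ell2_plus ell2_zero (ell2_opp ell2_zero)) with (ell2_scal zero ell2_zero).
  apply Rle_trans with (1 := ell2_norm_scal zero ell2_zero).
  rewrite abs_zero; lra.
rewrite ell2_plus_opp_r; apply ell2_eq; intros n; exact (mult_zero_l zero).
Qed.

Lemma ell2_ball_center u (e : posreal) : ell2_ball u e u.
Proof.
unfold ell2_ball; rewrite ell2_plus_opp_r, ell2_norm_zero; apply cond_pos.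
Qed.

Lemma ell2_ball_sym u v (e : R) : ell2_ball u e v -> ell2_ball v e u.
Proof.
unfold ell2_ball; rewrite <- (ell2_norm_opp (ell2_plus v _)).
replace (ell2_opp (ell2_plus v (ell2_opp u))) with (ell2_plus u (ell2_opp v));
  trivial.
apply ell2_eq; intros n; symmetry.
exact (opp_minus (coef v n) (coef u n)).
Qed.

Lemma ell2_ball_triangle u v w (e1 e2 : R) :
  ell2_ball u e1 v -> ell2_ball v e2 w -> ell2_ball u (e1 + e2) w.
Proof.
unfold ell2_ball; intros h1 h2.
replace (ell2_plus w (ell2_opp u)) with
  (ell2_plus (ell2_plus v (ell2_opp u)) (ell2_plus w (ell2_opp v))).
  apply Rle_lt_trans with (1 := ell2_norm_triangle _ _); lra.
apply ell2_eq; intros n.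
refine (eq_trans (plus_comm _ _) _); symmetry.
exact (minus_trans (coef v n) (coef w n) (coef u n)).
Qed.

End Ell2.

Section Ell2Structures.

Variable K : AbsRing.

Definition ell2_AbelianMonoid_mixin :=
  AbelianMonoid.Mixin (ell2 K) ell2_plus ell2_zero
    ell2_plus_comm ell2_plus_assoc ell2_plus_zero_r.
Canonical ell2_AbelianMonoid :=
  AbelianMonoid.Pack (ell2 K) ell2_AbelianMonoid_mixin (ell2 K).

Definition ell2_AbelianGroup_mixin :=
  AbelianGroup.Mixin ell2_AbelianMonoid ell2_opp ell2_plus_opp_r.
Canonical ell2_AbelianGroup :=
  AbelianGroup.Pack (ell2 K)
    (AbelianGroup.Class _ _ ell2_AbelianGroup_mixin) (ell2 K).

Definition ell2_ModuleSpace_mixin :=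
  ModuleSpace.Mixin K ell2_AbelianGroup ell2_scal
    ell2_scal_assoc ell2_scal_one ell2_scal_distr_l ell2_scal_distr_r.
Canonical ell2_ModuleSpace :=
  ModuleSpace.Pack K (ell2 K)
    (ModuleSpace.Class _ _ _ ell2_ModuleSpace_mixin) (ell2 K).

Definition ell2_UniformSpace_mixin :=
  UniformSpace.Mixin (ell2 K) ell2_zero ell2_ball
    ell2_ball_center ell2_ball_sym ell2_ball_triangle.
Canonical ell2_UniformSpace :=
  UniformSpace.Pack (ell2 K) ell2_UniformSpace_mixin (ell2 K).

Canonical ell2_NormedModuleAux :=
  NormedModuleAux.Pack K (ell2 K)
    (NormedModuleAux.Class K (ell2 K)
      (ModuleSpace.class K ell2_ModuleSpace) ell2_UniformSpace_mixin) (ell2 K).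

Lemma ell2_norm_ball (u v : ell2 K) (e : R) :
  ell2_norm (minus v u) < e -> ball u e v.
Proof. trivial. Qed.

Lemma ell2_ball_norm (u v : ell2 K) (e : posreal) :
  ball u e v -> ell2_norm (minus v u) < 1 * e.
Proof. now rewrite Rmult_1_l. Qed.

Definition ell2_NormedModule_mixin :=
  NormedModule.Mixin K ell2_NormedModuleAux ell2_norm 1
    ell2_norm_triangle ell2_norm_scal ell2_norm_ball ell2_ball_norm
    ell2_norm_eq_zero.
Canonical ell2_NormedModule : NormedModule K :=
  NormedModule.Pack K (ell2 K)
    (NormedModule.Class K (ell2 K) _ ell2_NormedModule_mixin) (ell2 K).

End Ell2Structures.

Section Systems.

Context {K : AbsRing} {X : NormedModule K}.

Definition in_span (x : nat -> X) (u : X) : Prop :=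
  exists (c : nat -> K) (N : nat), u = sum_n (fun k => scal (c k) (x k)) N.

Definition in_closed_span (x : nat -> X) (u : X) : Prop :=
  forall e : posreal, exists v : X, in_span x v /\ ball_norm u e v.

(** [is_linear] is Coquelicot's predicate: linear and bounded. *)
Definition is_functional (f : X -> K) : Prop :=
  is_linear (V := AbsRing_NormedModule K) f.

(** The set is nonempty, and bounded when [f] is a functional, so that its
    least upper bound is then finite. *)
Definition dual_norm (f : X -> K) : R :=
  real (Lub_Rbar (fun r => exists u : X, norm u <= 1 /\ r = abs (f u))).

Definition biorthogonal (x : nat -> X) (xs : nat -> X -> K) : Prop :=
  (forall n, is_functional (xs n)) /\
  (forall n m, xs n (x m) = if Nat.eqb n m then one else zero).

Definition fundamental (x : nat -> X) : Prop :=
  forall u : X, in_closed_span x u.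

Definition total (xs : nat -> X -> K) : Prop :=
  forall u : X, (forall n, xs n u = zero) -> u = zero.

Definition M_basis (x : nat -> X) (xs : nat -> X -> K) : Prop :=
  biorthogonal x xs /\ fundamental x /\ total xs.

Definition bounded_system (eps : nat -> R)
    (x : nat -> X) (xs : nat -> X -> K) : Prop :=
  forall n, norm (x n) * dual_norm (xs n) <= 1 + eps n.

Definition schauder_basis (y : nat -> X) : Prop :=
  forall u : X, exists a : nat -> K,
    is_series (fun n => scal (a n) (y n)) u /\
    (forall b : nat -> K, is_series (fun n => scal (b n) (y n)) u ->
       forall n, b n = a n).

End Systems.

Section Equivalence.

Context {K : AbsRing}.

(** Bounded linear maps between subspaces [S] and [T], given by functions on
    the ambient spaces whose values outside [S] are irrelevant. *)
Definition bounded_linear_between {X Y : NormedModule K}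
    (S : X -> Prop) (T : Y -> Prop) (A : X -> Y) : Prop :=
  (forall u, S u -> T (A u)) /\
  (forall u v, S u -> S v -> A (plus u v) = plus (A u) (A v)) /\
  (forall (k : K) u, S u -> A (scal k u) = scal k (A u)) /\
  (exists M : R, forall u, S u -> norm (A u) <= M * norm u).

(** The relation is of interest for minimal systems, where [A (x n) = y n]
    determines [A] on the span; minimality itself is not part of it. *)
Definition equivalent_systems {X Y : NormedModule K}
    (x : nat -> X) (y : nat -> Y) : Prop :=
  exists (A : X -> Y) (B : Y -> X),
    bounded_linear_between (in_closed_span x) (in_closed_span y) A /\
    bounded_linear_between (in_closed_span y) (in_closed_span x) B /\
    (forall u, in_closed_span x u -> B (A u) = u) /\
    (forall v, in_closed_span y v -> A (B v) = v) /\
    (forall n, A (x n) = y n).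

End Equivalence.

(* Main.v *)
Require Import Defs.
From Stdlib Require Import Reals Lra Lia PeanoNat IndefiniteDescription.
From Coquelicot Require Import Coquelicot.

(** Cut the indices into consecutive blocks, the block [j] of even size [N], and
    let [T] act on each block as follows: it multiplies the constant vectors of
    the block by a factor [t j >= 1] and fixes the vectors of zero sum. The
    system consists of the images of the unit vectors under [T], with the
    coordinate functionals composed with the inverse of [T]. On every block [T]
    is invertible, so this is an M-basis ([dilated_M_basis]). Since a unit
    vector has a component of squared length [1 / N] along the constants,
    the squared norm of the image is [1 + (t j ^ 2 - 1) / N], whereas the
    functionals have norm at most 1. The system is therefore
    [(1 + eps n)]-bounded as soon as [t j ^ 2 / N <= eps n] on the block, and
    the growth of [n * eps n] makes this possible with [t j] as large as
    desired, provided that the block is long compared with the preceding ones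
    ([dilated_bounded], [large_block_exists]).

    The norm of [T] on the blocks tends to infinity, and this rules out
    every ordering at once. In any ordering there is a stage at which
    exactly half of the block [j] has been listed ([block_initial_part]).
    Consider the vector that is constant on this half and takes the opposite
    value on the other half. It has zero sum, so its coefficients are its
    plain coordinates, and the partial sum of its expansion at this stage is
    the image under [T] of its restriction to the listed half. This
    restriction keeps the coordinates of one sign only; it has a large mean,
    which [T] multiplies by [t j]. The partial sum is thus at least
    [t j / 2] times as long as the vector ([norm_partial_sum_ge]). Adding such
    vectors over all blocks, with norms [2 ^ - j] and [t j = 4 ^ j], yields
    one vector of finite norm whose expansion has unbounded partial sums. If
    the reordered system were equivalent to a Schauder basis, each vector
    would have a convergent expansion ([equivalent_schauder_expansion]),
    necessarily the biorthogonal one ([biorthogonal_coefficients]), a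
    contradiction. *)

Open Scope R_scope.

(** * Finite sums *)

(** A relation compatible with addition passes from terms to sums; induction
    principles, morphisms and vanishing are instances. *)
Lemma sum_n_m_rel {G H : AbelianMonoid} (Q : G -> H -> Prop)
    (a : nat -> G) (b : nat -> H) (p q : nat) :
  Q zero zero ->
  (forall g g' h h', Q g h -> Q g' h' -> Q (plus g g') (plus h h')) ->
  (forall k, (p <= k <= q)%nat -> Q (a k) (b k)) ->
  Q (sum_n_m a p q) (sum_n_m b p q).
Proof.
intros h0 hp; induction q as [|q IH]; intros hab.
- destruct p as [|p].
    rewrite !sum_n_n; apply hab; lia.
  rewrite !sum_n_m_zero by lia; exact h0.
- destruct (Nat.le_gt_cases p (S q)) as [hpq|hpq].
    rewrite !sum_n_Sm by exact hpq.
    apply hp; [apply IH; intros k hk | ]; apply hab; lia.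
  rewrite !sum_n_m_zero by lia; exact h0.
Qed.

Lemma sum_n_m_ind {G : AbelianMonoid} (Q : G -> Prop) (a : nat -> G) (p q : nat) :
  Q zero -> (forall g h, Q g -> Q h -> Q (plus g h)) ->
  (forall k, (p <= k <= q)%nat -> Q (a k)) -> Q (sum_n_m a p q).
Proof.
intros h0 hp ha.
apply (sum_n_m_rel (fun g (_ : G) => Q g) a a); auto.
Qed.

Lemma sum_n_m_morph {G H : AbelianMonoid} (phi : G -> H) (a : nat -> G) (p q : nat) :
  phi zero = zero -> (forall g h, phi (plus g h) = plus (phi g) (phi h)) ->
  phi (sum_n_m a p q) = sum_n_m (fun k => phi (a k)) p q.
Proof.
intros h0 hp; apply (sum_n_m_rel (fun g h => phi g = h)); trivial.
intros g g' h h' <- <-; apply hp.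
Qed.

Lemma sum_n_m_eq_zero {G : AbelianMonoid} (a : nat -> G) (p q : nat) :
  (forall k, (p <= k <= q)%nat -> a k = zero) -> sum_n_m a p q = zero.
Proof.
intros ha; apply (sum_n_m_ind (fun g => g = zero)); trivial.
intros g h -> ->; apply plus_zero_l.
Qed.

Lemma sum_n_m_single {G : AbelianMonoid} (a : nat -> G) (p q i : nat) :
  (p <= i <= q)%nat ->
  (forall k, (p <= k <= q)%nat -> k <> i -> a k = zero) -> sum_n_m a p q = a i.
Proof.
intros hi ha.
rewrite (sum_n_m_Chasles a p i q) by lia.
rewrite (sum_n_m_eq_zero a (S i) q) by (intros k hk; apply ha; lia).
rewrite plus_zero_r; destruct i as [|i].
  replace p with 0%nat by lia; apply sum_n_n.
rewrite sum_n_Sm by lia.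
rewrite sum_n_m_eq_zero by (intros k hk; apply ha; lia).
apply plus_zero_l.
Qed.

Lemma sum_n_m_nonneg (a : nat -> R) (p q : nat) :
  (forall k, 0 <= a k) -> 0 <= sum_n_m a p q.
Proof.
intros ha; apply (sum_n_m_ind (G := R_AbelianMonoid) (fun r => 0 <= r)).
- apply Rle_refl.
- intros; now apply Rplus_le_le_0_compat.
- intros; apply ha.
Qed.

Lemma cauchy_schwarz_sum (a b : nat -> R) (p q : nat) :
  sum_n_m (fun k => a k * b k) p q ^ 2 <=
  sum_n_m (fun k => a k ^ 2) p q * sum_n_m (fun k => b k ^ 2) p q.
Proof.
(* The triples (A, B, C) with C^2 <= A B, A >= 0 and B >= 0 form a convex
   cone, so they are closed under addition. *)
set (Q := fun C (AB : R * R) =>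
  0 <= fst AB /\ 0 <= snd AB /\ C ^ 2 <= fst AB * snd AB).
assert (h : Q (sum_n_m (fun k => a k * b k) p q)
  (sum_n_m (G := prod_AbelianMonoid R_AbelianMonoid R_AbelianMonoid)
    (fun k => (a k ^ 2, b k ^ 2)) p q)).
  apply (sum_n_m_rel (G := R_AbelianMonoid)
    (H := prod_AbelianMonoid R_AbelianMonoid R_AbelianMonoid)); unfold Q.
  - simpl; unfold zero; simpl; lra.
  - intros C C' [A B] [A' B']; simpl.
    unfold plus; simpl; intros (hA & hB & hC) (hA' & hB' & hC').
    split; [lra | split; [lra |]].
    assert (h2 : (2 * (C * C')) ^ 2 <= (A * B' + A' * B) ^ 2).
      assert (C ^ 2 * C' ^ 2 <= A * B * (A' * B')).
        apply Rmult_le_compat; try apply pow2_ge_0; simpl; lra.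
      assert (0 <= (A * B' - A' * B) ^ 2) by apply pow2_ge_0.
      nra.
    assert (h3 : 2 * (C * C') <= A * B' + A' * B).
      apply Rsqr_incr_0_var; [rewrite !Rsqr_pow2; exact h2 |].
      apply Rplus_le_le_0_compat; now apply Rmult_le_pos.
    nra.
  - intros k _; simpl.
    split; [apply pow2_ge_0 | split; [apply pow2_ge_0 | nra]].
destruct h as (_ & _ & h).
rewrite (sum_n_m_morph (fun z : R * R => fst z)) in h by reflexivity.
rewrite (sum_n_m_morph (fun z : R * R => snd z)) in h by reflexivity.
exact h.
Qed.

(** * Spans, expansions and coefficients *)

Lemma minus_minus_l {G : AbelianGroup} (v w u : G) :
  minus (minus v w) (minus v u) = opp (minus w u).
Proof.
change (plus (plus v (opp w)) (opp (plus v (opp u))) = opp (plus w (opp u))).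
rewrite !opp_plus, !opp_opp, (plus_comm v (opp w)), <- plus_assoc.
now rewrite (plus_assoc v), plus_opp_r, plus_zero_l.
Qed.

Section Spans.

Context {K : AbsRing} {X : NormedModule K}.
Implicit Types (x : nat -> X) (u v : X).

Lemma in_span_widen x (c : nat -> K) (N M : nat) : (N <= M)%nat ->
  exists c' : nat -> K,
    sum_n (fun k => scal (c k) (x k)) N = sum_n (fun k => scal (c' k) (x k)) M.
Proof.
intros hNM; exists (fun k => if Nat.leb k N then c k else zero).
unfold sum_n; rewrite (sum_n_m_Chasles _ 0 N M) by lia.
rewrite (sum_n_m_eq_zero _ (S N) M).
  rewrite plus_zero_r; apply sum_n_m_ext_loc; intros k hk.
  now rewrite (proj2 (Nat.leb_le k N)) by lia.
intros k hk; rewrite (proj2 (Nat.leb_gt k N)) by lia.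
exact (scal_zero_l (x k)).
Qed.

Lemma in_span_zero x : in_span x zero.
Proof.
exists (fun _ => zero), 0%nat; rewrite sum_O; symmetry.
exact (scal_zero_l (x 0%nat)).
Qed.

Lemma in_span_plus x u v : in_span x u -> in_span x v -> in_span x (plus u v).
Proof.
intros (c & N & ->) (d & M & ->).
destruct (in_span_widen x c N (max N M)) as [c' ->]; [lia |].
destruct (in_span_widen x d M (max N M)) as [d' ->]; [lia |].
exists (fun k => plus (c' k) (d' k)), (max N M).
unfold sum_n; rewrite <- sum_n_m_plus; apply sum_n_m_ext; intros k.
symmetry; exact (scal_distr_r (c' k) (d' k) (x k)).
Qed.

Lemma in_span_scal x (k : K) u : in_span x u -> in_span x (scal k u).
Proof.
intros (c & N & ->); exists (fun i => mult k (c i)), N; unfold sum_n.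
rewrite (sum_n_m_morph (scal k)).
- apply sum_n_m_ext; intros i; apply scal_assoc.
- apply (scal_zero_r k).
- intros; apply (scal_distr_l k).
Qed.

Lemma in_span_sum x (f : nat -> X) (p q : nat) :
  (forall k, (p <= k <= q)%nat -> in_span x (f k)) -> in_span x (sum_n_m f p q).
Proof.
apply sum_n_m_ind; [apply in_span_zero | apply in_span_plus].
Qed.

Lemma in_span_term x (n : nat) : in_span x (x n).
Proof.
exists (fun k => if Nat.eqb k n then one else zero), n; unfold sum_n.
rewrite (sum_n_m_single _ 0 n n); [| lia |].
  rewrite Nat.eqb_refl; symmetry; exact (scal_one (x n)).
intros k _ hk; rewrite (proj2 (Nat.eqb_neq k n) hk).
exact (scal_zero_l (x k)).
Qed.

Lemma in_span_trans x (y : nat -> X) u :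
  (forall n, in_span y (x n)) -> in_span x u -> in_span y u.
Proof.
intros hxy (c & N & ->); apply in_span_sum; intros k _.
apply in_span_scal, hxy.
Qed.

Lemma in_span_closed_span x u : in_span x u -> in_closed_span x u.
Proof.
intros hu e; exists u; split; [exact hu | apply ball_norm_center].
Qed.

Lemma fundamental_of_span x (y : nat -> X) :
  (forall n, in_span y (x n)) -> fundamental x -> fundamental y.
Proof.
intros hxy hx u e; destruct (hx u e) as (v & hv & he).
exists v; split; [now apply (in_span_trans x) | exact he].
Qed.

(** Translating by [v] is an isometry that preserves the span, so the
    approximations of [u] become approximations of [minus v u]. *)
Lemma in_closed_span_minus x u v :
  in_span x v -> in_closed_span x u -> in_closed_span x (minus v u).
Proof.
intros hv hu e; destruct (hu e) as (w & hw & he).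
exists (minus v w); split.
  apply in_span_plus; [exact hv |].
  generalize (in_span_scal x (opp one) w hw); now rewrite scal_opp_one.
unfold ball_norm in *; rewrite (minus_minus_l v w u).
now rewrite norm_opp.
Qed.

End Spans.

(** The inverse isomorphism is continuous and maps [y n] back to [x n], hence it
    maps the basis expansion of the image of [u] to an expansion of [u]. *)
Lemma equivalent_schauder_expansion {K : AbsRing} {X Y : NormedModule K}
    (x : nat -> X) (y : nat -> Y) :
  schauder_basis y -> equivalent_systems x y ->
  forall u, in_closed_span x u ->
    exists a : nat -> K, is_series (fun n => scal (a n) (x n)) u.
Proof.
intros hy (A & B & (hA & _) & (_ & hBp & hBs & M & hBn) & hBA & _ & hAx) u hu.
destruct (hy (A u)) as (a & ha & _); exists a.
assert (hBy : forall n, B (y n) = x n).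
  intros n; rewrite <- hAx; apply hBA, in_span_closed_span, in_span_term.
assert (hpart : forall N, in_span y (sum_n (fun n => scal (a n) (y n)) N)).
  intros N; now exists a, N.
assert (hBsum : forall N, B (sum_n (fun n => scal (a n) (y n)) N)
    = sum_n (fun n => scal (a n) (x n)) N).
  assert (hterm : forall n, B (scal (a n) (y n)) = scal (a n) (x n)).
    intros n; rewrite hBs, hBy; trivial.
    apply in_span_closed_span, in_span_term.
  induction N as [|N IH].
    now rewrite !sum_O.
  rewrite !sum_Sn, hBp, IH, hterm; trivial; apply in_span_closed_span; trivial.
  apply in_span_scal, in_span_term.
assert (hAu : in_closed_span y (A u)) by now apply hA.
apply filterlim_locally_ball_norm; intros eps.
assert (hM : 0 < Rmax M 1) by (apply Rlt_le_trans with (2 := Rmax_r _ _); lra).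
assert (heps : 0 < eps / Rmax M 1)
  by (apply Rdiv_lt_0_compat; [apply cond_pos | exact hM]).
generalize (proj1 (filterlim_locally_ball_norm _ _) ha (mkposreal _ heps)).
apply filter_imp; intros N hN; unfold ball_norm in *; simpl in hN.
rewrite <- hBsum, <- (hBA u hu) at 1.
set (s := sum_n (fun n => scal (a n) (y n)) N) in *.
assert (hs : in_closed_span y s) by apply in_span_closed_span, hpart.
assert (hou : opp (A u) = minus zero (A u)) by (symmetry; apply plus_zero_l).
assert (hopp : in_closed_span y (opp (A u))).
  rewrite hou; apply in_closed_span_minus; [apply in_span_zero | exact hAu].
assert (hBmin : minus (B s) (B (A u)) = B (minus s (A u))).
  change (plus (B s) (opp (B (A u))) = B (plus s (opp (A u)))).
  rewrite hBp by trivial; apply (f_equal (plus (B s))).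
  generalize (hBs (opp one) (A u) hAu); rewrite !scal_opp_one.
  intros e; symmetry; exact e.
rewrite hBmin.
apply Rle_lt_trans with (Rmax M 1 * norm (minus s (A u))).
  apply Rle_trans with (M * norm (minus s (A u))).
    apply hBn, in_closed_span_minus; [apply hpart | exact hAu].
  apply Rmult_le_compat_r; [apply norm_ge_0 | apply Rmax_l].
replace (pos eps) with (Rmax M 1 * (eps / Rmax M 1)) by (field; lra).
now apply Rmult_lt_compat_l.
Qed.

(** Continuity of the functionals leaves no freedom in an expansion: it has to
    be the biorthogonal one. *)
Lemma biorthogonal_coefficients {K : AbsRing} {X : NormedModule K}
    (x : nat -> X) (xs : nat -> X -> K) (a : nat -> K) (u : X) :
  biorthogonal x xs -> is_series (fun n => scal (a n) (x n)) u ->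
  forall n, a n = xs n u.
Proof.
intros [hlin hxx] ha n.
destruct (hlin n) as [hp hs (M & hM & hn)].
(* The n-th functional takes the value a n on all partial sums from the n-th on. *)
assert (hpart : forall N, (n <= N)%nat ->
    xs n (sum_n (fun k => scal (a k) (x k)) N) = a n).
  intros N hN; unfold sum_n.
  rewrite (sum_n_m_morph (H := AbsRing_NormedModule K) (xs n)); [| | exact hp].
    rewrite (sum_n_m_single _ 0 N n) by
      (lia || (intros k _ hk; rewrite hs, hxx, (proj2 (Nat.eqb_neq n k)) by auto;
        exact (mult_zero_r (a k)))).
    rewrite hs, hxx, Nat.eqb_refl; exact (mult_one_r (a n)).
  rewrite <- (scal_zero_l (zero : X)) at 1; rewrite hs.
  exact (mult_zero_l (xs n zero)).
assert (hmin : forall v w, minus (xs n v) (xs n w) = xs n (minus v w)).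
  intros v w.
  change (plus (xs n v) (opp (xs n w)) = xs n (plus v (opp w))).
  rewrite hp; apply (f_equal (plus (xs n v))).
  generalize (hs (opp one) w).
  rewrite (scal_opp_one w), (scal_opp_one (xs n w : AbsRing_NormedModule K)).
  intros e; symmetry; exact e.
assert (hz : forall e : posreal,
    norm (minus (a n : AbsRing_NormedModule K) (xs n u)) <= e).
  intros e.
  assert (he : 0 < e / M) by (apply Rdiv_lt_0_compat; [apply cond_pos | exact hM]).
  destruct (proj1 (filterlim_locally_ball_norm _ _) ha (mkposreal _ he)) as [N hN].
  specialize (hN (max n N) (Nat.le_max_r n N)); unfold ball_norm in hN; simpl in hN.
  rewrite <- (hpart (max n N)) by lia.
  rewrite hmin; apply Rle_trans with (1 := hn _).
  replace (pos e) with (M * (e / M)) by (field; lra).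
  apply Rmult_le_compat_l; [left; exact hM | left; exact hN].
apply (plus_reg_r (opp (xs n u))); rewrite plus_opp_r.
apply abs_eq_zero, Rle_antisym; [| apply abs_ge_0].
apply le_epsilon; intros e he; rewrite Rplus_0_l.
exact (hz (mkposreal e he)).
Qed.

(** * Coordinates of square-summable sequences *)

Ltac as_reals := match goal with |- @eq _ ?a ?b => change (@eq R a b) end.

Lemma is_series_finite_support (f : nat -> R) (p q : nat) : (p <= q)%nat ->
  (forall k, ~ (p <= k <= q)%nat -> f k = 0) -> is_series f (sum_n_m f p q).
Proof.
intros hpq hf.
assert (hN : forall N, (q <= N)%nat -> sum_n f N = sum_n_m f p q).
  intros N hN; unfold sum_n.
  rewrite (sum_n_m_Chasles f 0 q N) by lia.
  rewrite (sum_n_m_eq_zero f (S q) N) by (intros k hk; apply hf; lia).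
  rewrite plus_zero_r; destruct p as [|p]; [reflexivity |].
  rewrite (sum_n_m_Chasles f 0 p q) by lia.
  rewrite (sum_n_m_eq_zero f 0 p) by (intros k hk; apply hf; lia).
  apply plus_zero_l.
apply filterlim_ext_loc with (fun _ => sum_n_m f p q).
  exists q; intros N h; symmetry; now apply hN.
apply filterlim_const.
Qed.

Section Coordinates.

Context {K : AbsRing}.
Implicit Types u v : ell2 K.

Lemma coef_sum (f : nat -> ell2 K) (p q k : nat) :
  coef (sum_n_m f p q) k = sum_n_m (fun i => coef (f i) k) p q.
Proof. now apply (sum_n_m_morph (fun u : ell2 K => coef u k)). Qed.

Lemma sum_sq_le_norm u (p q : nat) :
  sum_n_m (fun k => abs (coef u k) ^ 2) p q <= norm u ^ 2.
Proof.
change (norm u) with (ell2_norm u); rewrite ell2_norm_sq.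
destruct (Nat.le_gt_cases p q) as [hpq|hpq].
  2: { rewrite sum_n_m_zero by exact hpq; apply ell2_sq_norm_pos. }
set (f := fun k => if andb (Nat.leb p k) (Nat.leb k q) then abs (coef u k) ^ 2 else 0).
assert (hf : forall k, (p <= k <= q)%nat -> f k = abs (coef u k) ^ 2).
  intros k hk; unfold f; now rewrite !(proj2 (Nat.leb_le _ _)) by lia.
replace (sum_n_m _ p q) with (Series f).
  apply Series_le; [| apply coef_summable].
  intros k; assert (h := sq_abs_pos (coef u k)); unfold f.
  destruct (andb _ _); lra.
replace (sum_n_m _ p q) with (sum_n_m f p q).
  apply is_series_unique, is_series_finite_support; [exact hpq |].
  intros k hk; unfold f.
  destruct (Nat.leb_spec p k), (Nat.leb_spec k q); simpl; trivial; lia.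
now apply sum_n_m_ext_loc.
Qed.

Lemma abs_weighted_sum_le u (b : nat -> K) (p q : nat) :
  abs (sum_n_m (fun k => mult (coef u k) (b k)) p q) <=
  norm u * sqrt (sum_n_m (fun k => abs (b k) ^ 2) p q).
Proof.
apply Rle_trans with (sum_n_m (fun k => abs (coef u k) * abs (b k)) p q).
  apply Rle_trans with (1 := norm_sum_n_m (V := AbsRing_NormedModule K) _ p q).
  apply sum_n_m_le; intros k; apply abs_mult.
apply Rsqr_incr_0_var.
  2: { apply Rmult_le_pos; [apply norm_ge_0 | apply sqrt_pos]. }
rewrite !Rsqr_pow2, Rpow_mult_distr, pow2_sqrt.
  2: { apply sum_n_m_nonneg; intros k; apply pow2_ge_0. }
apply Rle_trans with (1 := cauchy_schwarz_sum _ _ p q).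
apply Rmult_le_compat_r; [| apply sum_sq_le_norm].
apply sum_n_m_nonneg; intros k; apply pow2_ge_0.
Qed.

Lemma unit_vector_summable (n : nat) :
  ex_series (fun k => abs (if Nat.eqb k n then one else zero : K) ^ 2).
Proof.
exists (sum_n_m (fun k => abs (if Nat.eqb k n then one else zero : K) ^ 2) n n).
apply is_series_finite_support; [lia | intros k hk].
rewrite (proj2 (Nat.eqb_neq k n)) by lia; rewrite abs_zero; ring.
Qed.

Definition unit_vector (n : nat) : ell2 K :=
  Ell2 (fun k => if Nat.eqb k n then one else zero) (unit_vector_summable n).

Lemma unit_vectors_fundamental : fundamental unit_vector.
Proof.
intros u e.
set (a := fun k => abs (coef u k) ^ 2).
assert (ha : ex_series a) by apply coef_summable.
assert (he : 0 < e ^ 2) by (apply pow_lt, cond_pos).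
destruct (proj1 (filterlim_locally _ _) (Series_correct a ha) (mkposreal _ he))
  as [N hN].
specialize (hN N (Nat.le_refl N)); change (Rabs (sum_n a N - Series a) < e ^ 2) in hN.
set (w := sum_n (fun k => scal (coef u k) (unit_vector k)) N).
exists w; split; [now exists (coef u), N |].
assert (hw : forall k, coef w k = if Nat.leb k N then coef u k else zero).
  intros k; unfold w, sum_n; rewrite coef_sum.
  destruct (Nat.leb_spec k N) as [hk|hk].
    rewrite (sum_n_m_single _ 0 N k); [| lia |].
      change (mult (coef u k) (if Nat.eqb k k then one else zero) = coef u k).
      rewrite Nat.eqb_refl; apply mult_one_r.
    intros i _ hi.
    change (mult (coef u i) (if Nat.eqb k i then one else zero) = zero).
    rewrite (proj2 (Nat.eqb_neq k i)) by auto; apply mult_zero_r.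
  apply sum_n_m_eq_zero; intros i hi.
  change (mult (coef u i) (if Nat.eqb k i then one else zero) = zero).
  rewrite (proj2 (Nat.eqb_neq k i)) by lia; apply mult_zero_r.
unfold ball_norm; change (ell2_norm (minus w u) < e).
apply Rsqr_incrst_0; [| apply ell2_norm_pos | left; apply cond_pos].
rewrite !Rsqr_pow2, ell2_norm_sq.
apply Rle_lt_trans with (2 := hN).
rewrite <- Rabs_Ropp; apply Rle_trans with (2 := Rle_abs _).
set (head := fun k => if Nat.leb k N then a k else 0).
assert (hhead : is_series head (sum_n a N)).
  replace (sum_n a N) with (sum_n_m head 0 N).
    apply is_series_finite_support; [lia |]; intros k hk; unfold head.
    rewrite (proj2 (Nat.leb_gt k N)) by lia; trivial.
  apply sum_n_m_ext_loc; intros k hk; unfold head.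
  now rewrite (proj2 (Nat.leb_le k N)) by lia.
right; apply is_series_unique.
apply is_series_ext with (fun k => minus (a k) (head k)).
  intros k; unfold head, a.
  change (coef (minus w u) k) with (minus (coef w k) (coef u k)).
  rewrite hw; destruct (Nat.leb k N).
    replace (minus (coef u k) (coef u k)) with (zero : K).
      rewrite abs_zero; change (abs (coef u k) ^ 2 + - abs (coef u k) ^ 2 = 0 ^ 2).
      ring.
    symmetry; exact (minus_eq_zero (coef u k)).
  transitivity (abs (opp (coef u k)) ^ 2).
    rewrite abs_opp; change (abs (coef u k) ^ 2 + - 0 = abs (coef u k) ^ 2); ring.
  apply (f_equal (fun c => abs c ^ 2)); symmetry.
  exact (plus_zero_l (opp (coef u k))).
replace (- (sum_n a N - Series a)) with (minus (Series a) (sum_n a N)).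
  apply (is_series_minus a head); [now apply Series_correct | exact hhead].
unfold minus, plus, opp; simpl; ring.
Qed.

End Coordinates.

(** * Partitions of the indices into intervals *)

(** A cut of the natural numbers into nonempty consecutive intervals, given by
    their left ends. *)
Record intervals := Intervals {
  first : nat -> nat;
  first_0 : first 0 = 0%nat;
  first_lt : forall j, (first j < first (S j))%nat
}.

Section Blocks.

Context (I : intervals).

Definition last (j : nat) : nat := pred (first I (S j)).

Definition size (j : nat) : nat := first I (S j) - first I j.

Fixpoint block (n : nat) : nat :=
  match n with
  | O => O
  | S n' => if Nat.eqb n (first I (S (block n'))) then S (block n') else block n'
  end.

Definition block_sum {G : AbelianMonoid} (j : nat) (f : nat -> G) : G :=
  sum_n_m f (first I j) (last j).

Lemma first_le_mono (i j : nat) : (i <= j)%nat -> (first I i <= first I j)%nat.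
Proof.
induction 1 as [|j _ IH]; [lia |].
assert (h := first_lt I j); lia.
Qed.

Lemma first_le_last (j : nat) : (first I j <= last j)%nat.
Proof. unfold last; assert (h := first_lt I j); lia. Qed.

Lemma size_pos (j : nat) : 0 < INR (size j).
Proof. apply lt_0_INR; unfold size; assert (h := first_lt I j); lia. Qed.

Lemma in_own_block (n : nat) : (first I (block n) <= n <= last (block n))%nat.
Proof.
unfold last; induction n as [|n IH].
  simpl; assert (h := first_lt I 0); rewrite first_0 in *; lia.
cbn [block]; destruct (Nat.eqb_spec (S n) (first I (S (block n)))) as [e|e].
  assert (h := first_lt I (S (block n))); lia.
assert (h := first_lt I (block n)); lia.
Qed.

Lemma block_unique (n j : nat) : (first I j <= n <= last j)%nat -> block n = j.
Proof.
intros hj; assert (hn := in_own_block n); unfold last in *.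
assert (h := first_lt I j).
destruct (Nat.lt_trichotomy (block n) j) as [l|[l|l]]; trivial.
  assert (h' := first_le_mono (S (block n)) j l).
  assert (h1 := first_lt I (block n)); lia.
assert (h' := first_le_mono (S j) (block n) l); lia.
Qed.

Lemma block_sum_const (j : nat) (a : R) : block_sum j (fun _ => a) = INR (size j) * a.
Proof.
unfold block_sum, last; rewrite sum_n_m_const; unfold size.
assert (h := first_lt I j).
now replace (S (pred (first I (S j)))) with (first I (S j)) by lia.
Qed.

Lemma block_sum_ext {G : AbelianMonoid} (j : nat) (f g : nat -> G) :
  (forall k, block k = j -> f k = g k) -> block_sum j f = block_sum j g.
Proof.
intros h; apply sum_n_m_ext_loc; intros k hk; now apply h, block_unique.
Qed.

Lemma block_sum_eq_zero {G : AbelianMonoid} (j : nat) (f : nat -> G) :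
  (forall k, block k = j -> f k = zero) -> block_sum j f = zero.
Proof.
intros h; apply sum_n_m_eq_zero; intros k hk; now apply h, block_unique.
Qed.

Lemma block_sum_single {G : AbelianMonoid} (i : nat) (f : nat -> G) :
  (forall k, k <> i -> f k = zero) -> block_sum (block i) f = f i.
Proof.
intros h; apply sum_n_m_single; [apply in_own_block |]; auto.
Qed.

Lemma block_sum_affine {A : Ring} (j : nat) (f g : nat -> A) (a : A) :
  block_sum j (fun k => plus (f k) (mult (g k) a)) =
  plus (block_sum j f) (mult (block_sum j g) a).
Proof.
unfold block_sum.
now rewrite (sum_n_m_plus f (fun k => mult (g k) a)), (sum_n_m_mult_r a g).
Qed.

Lemma block_sum_affine_R (j : nat) (f g : nat -> R) (a : R) :
  block_sum j (fun k => f k + g k * a) = block_sum j f + block_sum j g * a.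
Proof. exact (block_sum_affine (A := R_Ring) j f g a). Qed.

Lemma is_series_block_support (j : nat) (f : nat -> R) :
  (forall k, block k <> j -> f k = 0) -> is_series f (block_sum j f).
Proof.
intros h; apply is_series_finite_support; [apply first_le_last |].
intros k hk; apply h; intros <-; apply hk, in_own_block.
Qed.

(** As [f] is nonnegative, its partial sums are bounded by those at the ends of
    the blocks, which are sums of block sums. *)
Lemma ex_series_of_block_sums (f g : nat -> R) :
  (forall k, 0 <= f k) -> (forall j, block_sum j f <= g j) -> ex_series g ->
  ex_series f.
Proof.
intros hf hfg hg.
assert (hg0 : forall j, 0 <= g j).
  intros j; apply Rle_trans with (2 := hfg j); now apply sum_n_m_nonneg.
assert (hfin : forall h : nat -> R, (forall k, 0 <= h k) ->
    forall N, sum_n h N <= sum_n h (S N)).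
  intros h hh N; rewrite sum_Sn; change plus with Rplus; specialize (hh (S N)); lra.
assert (hblocks : forall j, sum_n f (last j) <= sum_n g j).
  intros j; induction j as [|j IH].
    generalize (hfg 0%nat); unfold block_sum; rewrite sum_O, first_0; trivial.
  rewrite sum_Sn; unfold sum_n.
  assert (h1 := first_le_last (S j)); assert (h2 := first_lt I j).
  rewrite (sum_n_m_Chasles f 0 (last j) (last (S j))); unfold last in *; [| lia | lia].
  apply Rplus_le_compat; [exact IH |].
  apply Rle_trans with (2 := hfg (S j)); right; unfold block_sum, last.
  f_equal; lia.
assert (hlast : forall N, (N <= last N)%nat).
  intros N; assert (h := first_le_last N).
  enough (N <= first I N)%nat by lia; clear h.
  induction N as [|N IH]; [lia |]; assert (h := first_lt I N); lia.
destruct (ex_finite_lim_seq_incr (sum_n f) (Series g)) as [l hl].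
- now apply hfin.
- intros N; apply Rle_trans with (sum_n f (last N)).
    assert (h := hlast N); revert h; generalize (last N).
    induction 1 as [|M _ IH]; [lra |]; specialize (hfin f hf M); lra.
  apply Rle_trans with (1 := hblocks N).
  apply (is_lim_seq_incr_compare (sum_n g) (Series g)); [| now apply hfin].
  exact (Series_correct g hg).
- now exists l.
Qed.

(** * Dilating the constants of every block *)

(** The matrix of the operator that multiplies the vectors constant on the
    block [j] by [t j] and fixes the vectors of zero sum on every block. *)
Definition dilation (t : nat -> R) (k l : nat) : R :=
  (if Nat.eqb k l then 1 else 0) +
  (if Nat.eqb (block k) (block l) then (t (block k) - 1) / INR (size (block k)) else 0).

Lemma dilation_outside (t : nat -> R) (k l : nat) :
  block k <> block l -> dilation t k l = 0.
Proof.
intros h; unfold dilation; rewrite (proj2 (Nat.eqb_neq _ _) h).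
rewrite (proj2 (Nat.eqb_neq k l)) by (intros ->; auto); ring.
Qed.

Lemma dilation_inside (t : nat -> R) (k l : nat) : block k = block l ->
  dilation t k l =
  (if Nat.eqb k l then 1 else 0) + (t (block k) - 1) / INR (size (block k)).
Proof. intros h; unfold dilation; now rewrite h, Nat.eqb_refl. Qed.

Lemma dilation_sym (t : nat -> R) (k l : nat) : dilation t k l = dilation t l k.
Proof.
unfold dilation; rewrite (Nat.eqb_sym k l), (Nat.eqb_sym (block k)).
destruct (Nat.eqb_spec (block l) (block k)) as [->|_]; reflexivity.
Qed.

Lemma dilation_row_sum (t : nat -> R) (j k : nat) :
  block_sum j (dilation t k) = if Nat.eqb (block k) j then t j else 0.
Proof.
destruct (Nat.eqb_spec (block k) j) as [<-|h].
  rewrite (block_sum_ext _ _ (fun l => (if Nat.eqb k l then 1 else 0) +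
    1 * ((t (block k) - 1) / INR (size (block k))))).
    rewrite (block_sum_affine_R (block k) _ (fun _ => 1)).
    rewrite (block_sum_single (G := R_AbelianMonoid)), Nat.eqb_refl.
      rewrite (block_sum_const (block k) 1).
      as_reals; field; apply Rgt_not_eq, size_pos.
    intros l hl; now rewrite (proj2 (Nat.eqb_neq k l)) by auto.
  intros l hl; rewrite dilation_inside by auto; as_reals; ring.
apply (block_sum_eq_zero (G := R_AbelianMonoid)); intros l hl.
apply dilation_outside; congruence.
Qed.

(** On a block, a dilation by [t] is the identity plus [t - 1] times the
    projection onto the constants, so that factors multiply under composition.
    Biorthogonality, the norms of the rows and the inversion formula are all
    instances of this identity. *)
Lemma dilation_mult (s t : nat -> R) (k m : nat) :
  block_sum (block k) (fun l => dilation s k l * dilation t l m) =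
  dilation (fun j => s j * t j) k m.
Proof.
destruct (Nat.eq_dec (block k) (block m)) as [h|h].
  rewrite (block_sum_ext _ _ (fun l => dilation s k l * (if Nat.eqb l m then 1 else 0)
    + dilation s k l * ((t (block k) - 1) / INR (size (block k))))).
    rewrite (block_sum_affine_R (block k) _ (dilation s k)).
    rewrite dilation_row_sum, Nat.eqb_refl, h.
    rewrite (block_sum_single (G := R_AbelianMonoid)), Nat.eqb_refl.
      rewrite !dilation_inside, !h by exact h.
      as_reals; field; apply Rgt_not_eq, size_pos.
    intros l hl; rewrite (proj2 (Nat.eqb_neq l m) hl); apply Rmult_0_r.
  intros l hl; rewrite (dilation_inside t l m), hl by congruence; as_reals; ring.
rewrite (dilation_outside _ k m h); apply (block_sum_eq_zero (G := R_AbelianMonoid)).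
intros l hl; rewrite (dilation_outside t l m) by congruence; apply Rmult_0_r.
Qed.

Lemma dilation_one (t : nat -> R) (k l : nat) :
  (forall j, t j = 1) -> dilation t k l = if Nat.eqb k l then 1 else 0.
Proof.
intros h; unfold dilation; rewrite h; destruct (Nat.eqb (block k) _); [| ring].
unfold Rdiv; ring.
Qed.

Lemma dilation_row_norm (t : nat -> R) (k : nat) :
  block_sum (block k) (fun l => dilation t k l ^ 2) =
  1 + (t (block k) ^ 2 - 1) / INR (size (block k)).
Proof.
rewrite (block_sum_ext _ _ (fun l => dilation t k l * dilation t l k)).
  rewrite dilation_mult, dilation_inside, Nat.eqb_refl by reflexivity.
  unfold Rdiv; as_reals; ring.
intros l _; rewrite (dilation_sym t l k); as_reals; ring.
Qed.

End Blocks.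

(** * The dilated unit vectors and their biorthogonal functionals *)

(** What the construction uses about the scalars: it only needs real coefficients,
    embedded isometrically. Both the real and the complex field are covered. *)
Record real_embedding (K : AbsRing) := RealEmbedding {
  emb :> R -> K;
  emb_plus : forall a b, emb (a + b) = plus (emb a) (emb b);
  emb_mult : forall a b, emb (a * b) = mult (emb a) (emb b);
  emb_1 : emb 1 = one;
  abs_emb : forall a, abs (emb a) = Rabs a
}.
Arguments emb_plus {K} _ _ _.
Arguments emb_mult {K} _ _ _.
Arguments emb_1 {K} _.
Arguments abs_emb {K} _ _.

Section System.

Context {K : AbsRing} (iota : real_embedding K) (I : intervals).
Context (t : nat -> R) (t_ge_1 : forall j, 1 <= t j).

Lemma emb_0 : iota 0 = zero.
Proof. apply abs_eq_zero; rewrite abs_emb; apply Rabs_R0. Qed.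

Lemma emb_if (b : bool) : iota (if b then 1 else 0) = if b then one else zero.
Proof. destruct b; [apply emb_1 | apply emb_0]. Qed.

Lemma emb_block_sum (j : nat) (f : nat -> R) :
  iota (block_sum I j f) = block_sum I j (fun k => iota (f k)).
Proof.
apply (sum_n_m_morph (G := R_AbelianMonoid) iota); [apply emb_0 | apply emb_plus].
Qed.

Lemma abs_emb_sq (a : R) : abs (iota a) ^ 2 = a ^ 2.
Proof. rewrite abs_emb; apply pow2_abs. Qed.

Lemma dilated_is_series (n : nat) :
  is_series (fun k => abs (iota (dilation I t n k)) ^ 2)
    (1 + (t (block I n) ^ 2 - 1) / INR (size I (block I n))).
Proof.
rewrite <- dilation_row_norm.
apply is_series_ext with (fun k => dilation I t n k ^ 2).
  intros k; symmetry; apply abs_emb_sq.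
apply is_series_block_support; intros k hk.
rewrite dilation_outside by auto; ring.
Qed.

(** The image of a unit vector under the dilation by [t]; the dilation is
    symmetric, so rows and columns agree. *)
Definition dilated (n : nat) : ell2 K :=
  Ell2 (fun k => iota (dilation I t n k)) (ex_intro _ _ (dilated_is_series n)).

(** A coordinate functional composed with the inverse dilation. *)
Definition codilated (n : nat) (u : ell2 K) : K :=
  block_sum I (block I n)
    (fun k => mult (coef u k) (iota (dilation I (fun j => / t j) n k))).

Lemma t_pos (j : nat) : 0 < t j.
Proof. apply Rlt_le_trans with (2 := t_ge_1 j); lra. Qed.

Lemma norm_dilated (n : nat) :
  norm (dilated n) = sqrt (1 + (t (block I n) ^ 2 - 1) / INR (size I (block I n))).
Proof.
change (sqrt (Series (fun k => abs (iota (dilation I t n k)) ^ 2)) =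
  sqrt (1 + (t (block I n) ^ 2 - 1) / INR (size I (block I n)))).
f_equal; apply is_series_unique, dilated_is_series.
Qed.

(** As [t] is at least 1, the inverse dilation is a contraction; concretely,
    its rows have norm at most 1, and the Cauchy-Schwarz inequality applies. *)
Lemma abs_codilated_le (n : nat) (u : ell2 K) : abs (codilated n u) <= norm u.
Proof.
apply Rle_trans with (1 := abs_weighted_sum_le u _ _ _).
apply Rle_trans with (norm u * sqrt 1); [| rewrite sqrt_1; lra].
apply Rmult_le_compat_l; [apply norm_ge_0 |]; apply sqrt_le_1_alt.
change (block_sum I (block I n)
  (fun k => abs (iota (dilation I (fun j => / t j) n k)) ^ 2) <= 1).
rewrite (block_sum_ext I _ _ (fun k => dilation I (fun j => / t j) n k ^ 2))
  by (intros k _; apply abs_emb_sq).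
rewrite dilation_row_norm.
assert (h : (/ t (block I n)) ^ 2 <= 1).
  rewrite <- (pow1 2); apply pow_incr; split.
    left; apply Rinv_0_lt_compat, t_pos.
  rewrite <- Rinv_1; apply Rinv_le_contravar; [lra | apply t_ge_1].
assert (hs := Rinv_0_lt_compat _ (size_pos I (block I n))).
unfold Rdiv; nra.
Qed.

Lemma codilated_is_functional (n : nat) : is_functional (codilated n).
Proof.
split.
- intros u v; unfold codilated, block_sum.
  rewrite <- (sum_n_m_plus (G := AbsRing_NormedModule K)).
  apply sum_n_m_ext; intros k.
  exact (mult_distr_r (coef u k) (coef v k) _).
- intros c u; unfold codilated, block_sum.
  rewrite <- (sum_n_m_scal_l (V := AbsRing_NormedModule K)).
  apply sum_n_m_ext; intros k; symmetry.
  exact (mult_assoc c (coef u k) _).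
- exists 1; split; [lra | intros u; rewrite Rmult_1_l; apply abs_codilated_le].
Qed.

Lemma dual_norm_codilated_le (n : nat) : dual_norm (codilated n) <= 1.
Proof.
unfold dual_norm.
match goal with |- real (Lub_Rbar ?E) <= 1 =>
  assert (h : Rbar_le (Lub_Rbar E) (Finite 1)) end.
  apply Lub_Rbar_correct; intros r (u & hu & ->).
  now apply Rle_trans with (1 := abs_codilated_le n u).
destruct (Lub_Rbar _); simpl in *; [exact h | contradiction | lra].
Qed.

Lemma block_sum_dilated (j n : nat) :
  block_sum I j (coef (dilated n)) = iota (if Nat.eqb (block I n) j then t j else 0).
Proof. now rewrite <- dilation_row_sum, emb_block_sum. Qed.

Lemma dilated_biorthogonal : biorthogonal dilated codilated.
Proof.
split; [exact codilated_is_functional | intros n m; unfold codilated].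
rewrite (block_sum_ext I _ _
  (fun k => iota (dilation I (fun j => / t j) n k * dilation I t k m))).
  rewrite <- emb_block_sum, dilation_mult, dilation_one.
    apply emb_if.
  intros j; apply Rinv_l, Rgt_not_eq, t_pos.
intros k _; rewrite Rmult_comm, emb_mult, (dilation_sym I t k m); reflexivity.
Qed.

(** In particular the functional is the plain coordinate on vectors with zero
    sum on the block. *)
Lemma codilated_block_sum (n : nat) (u : ell2 K) :
  codilated n u = plus (coef u n) (mult (block_sum I (block I n) (coef u))
    (iota ((/ t (block I n) - 1) / INR (size I (block I n))))).
Proof.
unfold codilated.
rewrite (block_sum_ext I _ _ (fun k => plus
  (mult (coef u k) (if Nat.eqb n k then one else zero))
  (mult (coef u k) (iota ((/ t (block I n) - 1) / INR (size I (block I n))))))).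
  rewrite block_sum_affine, block_sum_single, Nat.eqb_refl.
    now rewrite mult_one_r.
  intros k hk; rewrite (proj2 (Nat.eqb_neq n k)) by auto; apply mult_zero_r.
intros k hk; rewrite dilation_inside by auto.
rewrite emb_plus, emb_if; exact (mult_distr_l (coef u k) _ _).
Qed.

Lemma codilated_total : total codilated.
Proof.
intros u hu.
assert (hsum : forall j, block_sum I j (coef u) = zero).
  intros j.
  set (S := block_sum I j (coef u)); set (d := (/ t j - 1) / INR (size I j)).
  assert (h : plus S (mult S (iota (INR (size I j) * d))) = zero).
    rewrite <- block_sum_const, emb_block_sum.
    unfold S at 2, block_sum at 2; rewrite <- (sum_n_m_mult_l S).
    unfold S at 1, block_sum; rewrite <- sum_n_m_plus.
    apply sum_n_m_eq_zero; intros n hn; rewrite <- (hu n), codilated_block_sum.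
    now rewrite (block_unique I n j hn).
  assert (h' : mult S (iota (/ t j)) = zero).
    replace (/ t j) with (1 + INR (size I j) * d).
      rewrite emb_plus, emb_1; refine (eq_trans (mult_distr_l S _ _) _).
      now rewrite mult_one_r.
    unfold d; field; split; apply Rgt_not_eq; [apply t_pos | apply size_pos].
  rewrite <- (mult_one_r S), <- (emb_1 iota), <- (Rinv_l (t j)).
    rewrite emb_mult, mult_assoc, h'.
    exact (mult_zero_l (iota (t j))).
  apply Rgt_not_eq, t_pos.
apply ell2_eq; intros n.
generalize (hu n); rewrite codilated_block_sum, hsum; intros e.
refine (eq_trans _ e); symmetry.
exact (eq_trans (f_equal (plus (coef u n)) (mult_zero_l _)) (plus_zero_r _)).
Qed.

Lemma unit_vector_dilated (n : nat) :
  unit_vector n = block_sum I (block I n)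
    (fun k => scal (iota (dilation I (fun j => / t j) n k)) (dilated k)).
Proof.
apply ell2_eq; intros m; refine (eq_trans _ (eq_sym (coef_sum _ _ _ m))).
transitivity (block_sum I (block I n)
  (fun k => iota (dilation I (fun j => / t j) n k * dilation I t k m))).
  rewrite <- emb_block_sum, dilation_mult, dilation_one.
    now rewrite emb_if, Nat.eqb_sym.
  intros j; apply Rinv_l, Rgt_not_eq, t_pos.
apply block_sum_ext; intros k _; apply emb_mult.
Qed.

Lemma dilated_fundamental : fundamental dilated.
Proof.
apply (fundamental_of_span unit_vector); [| apply unit_vectors_fundamental].
intros n; rewrite unit_vector_dilated; unfold block_sum.
apply (in_span_sum dilated); intros k _.
apply (in_span_scal (X := ell2_NormedModule K) dilated).
apply (in_span_term (X := ell2_NormedModule K)).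
Qed.

Lemma dilated_M_basis : M_basis dilated codilated.
Proof.
split; [apply dilated_biorthogonal |].
split; [apply dilated_fundamental | apply codilated_total].
Qed.

(** Only the norm of [dilated n] exceeds 1, and its square exceeds 1 by less
    than the square of the dilation factor divided by the size of the block:
    the constant direction has a small component on each unit vector of a long
    block. *)
Lemma dilated_bounded (eps : nat -> R) :
  (forall n, 0 < eps n) ->
  (forall n, t (block I n) ^ 2 <= INR (size I (block I n)) * eps n) ->
  bounded_system eps dilated codilated.
Proof.
intros heps ht n.
apply Rle_trans with (norm (dilated n) * 1).
  apply Rmult_le_compat_l; [apply norm_ge_0 | apply dual_norm_codilated_le].
rewrite Rmult_1_r, norm_dilated; specialize (heps n); specialize (ht n).
apply Rle_trans with (sqrt ((1 + eps n) ^ 2)); [apply sqrt_le_1_alt |].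
  assert (hs := size_pos I (block I n)).
  assert ((t (block I n) ^ 2 - 1) / INR (size I (block I n)) <= eps n); [| nra].
  apply Rmult_le_reg_l with (1 := hs); field_simplify; lra.
rewrite sqrt_pow2; lra.
Qed.

End System.

(** * No ordering gives a Schauder basis *)

(** Counting functions move by steps of 0 or 1, so they skip no integer. *)
Lemma sum_n_indicator_values (p : nat -> bool) (n : nat) :
  exists q, sum_n (fun i => if p i then 1 else 0) n = INR q /\
    forall m, (0 < m <= q)%nat ->
      exists i, sum_n (fun i => if p i then 1 else 0) i = INR m.
Proof.
induction n as [|n (q & hq & IH)].
  exists (if p 0%nat then 1%nat else 0%nat); rewrite sum_O; split.
    destruct (p 0%nat); reflexivity.
  intros m hm; exists 0%nat; rewrite sum_O; destruct (p 0%nat); [| lia].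
  now replace m with 1%nat by lia.
assert (hS : sum_n (fun i => if p i then 1 else 0) (S n) =
    INR (if p (S n) then S q else q)).
  rewrite sum_Sn, hq; change plus with Rplus.
  destruct (p (S n)); [now rewrite S_INR | apply Rplus_0_r].
exists (if p (S n) then S q else q); split; [exact hS |]; intros m hm.
destruct (Nat.le_gt_cases m q) as [h|h]; [apply IH; lia |].
exists (S n); rewrite hS; f_equal; destruct (p (S n)); lia.
Qed.

Lemma nat_bounded_on_initial (f : nat -> nat) (q : nat) :
  exists n, forall k, (k <= q)%nat -> (f k <= n)%nat.
Proof.
induction q as [|q (n & hn)].
  exists (f 0%nat); intros k hk; now replace k with 0%nat by lia.
exists (max n (f (S q))); intros k hk.
destruct (Nat.eq_dec k (S q)) as [->|h]; [lia |].
assert (h' := hn k); lia.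
Qed.

Lemma block_sum_switch {G : AbelianMonoid} (I : intervals) (j n : nat)
    (f : nat -> nat -> G) :
  sum_n (fun i => block_sum I j (f i)) n =
  block_sum I j (fun k => sum_n (fun i => f i k) n).
Proof.
induction n as [|n IH].
  rewrite sum_O; apply block_sum_ext; intros k _; now rewrite sum_O.
rewrite sum_Sn, IH; unfold block_sum; rewrite <- sum_n_m_plus.
apply sum_n_m_ext; intros k; now rewrite sum_Sn.
Qed.

Section Ordering.

Context (I : intervals) (sigma tau : nat -> nat).
Context (tau_sigma : forall i, tau (sigma i) = i).
Context (sigma_tau : forall k, sigma (tau k) = k).

(** Counting by time of visit or by place gives the same number: both sides
    sum the matrix of the permutation over the same rectangle. *)
Lemma block_count_switch (j n : nat) :
  sum_n (fun i => if Nat.eqb (block I (sigma i)) j then 1 else 0) n =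
  block_sum I j (fun k => if Nat.leb (tau k) n then 1 else 0).
Proof.
transitivity (sum_n (fun i =>
    block_sum I j (fun k => if Nat.eqb (sigma i) k then 1 else 0)) n).
  apply sum_n_ext; intros i.
  destruct (Nat.eqb_spec (block I (sigma i)) j) as [<-|h].
    rewrite (block_sum_single I (G := R_AbelianMonoid)), Nat.eqb_refl; trivial.
    intros k hk; now rewrite (proj2 (Nat.eqb_neq (sigma i) k)) by auto.
  symmetry; apply (block_sum_eq_zero I (G := R_AbelianMonoid)); intros k hk.
  rewrite (proj2 (Nat.eqb_neq (sigma i) k)); trivial; congruence.
rewrite (block_sum_switch I j n (fun i k => if Nat.eqb (sigma i) k then 1 else 0)).
apply block_sum_ext; intros k _; destruct (Nat.leb_spec (tau k) n) as [h|h].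
  unfold sum_n; rewrite (sum_n_m_single (G := R_AbelianMonoid) _ 0 n (tau k)).
  - now rewrite sigma_tau, Nat.eqb_refl.
  - lia.
  - intros i _ hi; rewrite (proj2 (Nat.eqb_neq (sigma i) k)); trivial.
    intros <-; apply hi; now rewrite tau_sigma.
apply (sum_n_m_eq_zero (G := R_AbelianMonoid)); intros i hi.
rewrite (proj2 (Nat.eqb_neq (sigma i) k)); trivial.
intros <-; rewrite tau_sigma in h; lia.
Qed.

(** The number of indices of the block that have been listed rises to the size
    of the block by steps of at most 1. *)
Lemma block_initial_part (j m : nat) : (0 < m <= size I j)%nat ->
  exists n, block_sum I j (fun k => if Nat.leb (tau k) n then 1 else 0) = INR m.
Proof.
intros hm; destruct (nat_bounded_on_initial tau (last I j)) as [N hN].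
destruct (sum_n_indicator_values (fun i => Nat.eqb (block I (sigma i)) j) N)
  as (q & hq & hval).
rewrite block_count_switch, (block_sum_ext I j _ (fun _ => 1)), block_sum_const,
  Rmult_1_r in hq.
  apply INR_eq in hq; destruct (hval m) as [n hn]; [lia |].
  now exists n; rewrite <- block_count_switch.
intros k hk; assert (h := in_own_block I k); rewrite hk in h.
rewrite (proj2 (Nat.leb_le (tau k) N)); trivial; apply hN; lia.
Qed.

End Ordering.

Section NoBasis.

Context {K : AbsRing} (iota : real_embedding K) (I : intervals).
Context (t : nat -> R) (t_ge_1 : forall j, 1 <= t j).
Context (half : nat -> nat) (size_half : forall j, size I j = (2 * half j)%nat).

Lemma abs_block_sum_le (j : nat) (u : ell2 K) :
  abs (block_sum I j (coef u)) <= norm u * sqrt (INR (size I j)).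
Proof.
generalize (abs_weighted_sum_le u (fun _ => iota 1) (first I j) (last I j)).
change (sum_n_m (fun _ : nat => abs (iota 1) ^ 2) (first I j) (last I j))
  with (block_sum I j (fun _ : nat => abs (iota 1) ^ 2)).
rewrite block_sum_const, abs_emb, Rabs_R1, pow1, Rmult_1_r.
rewrite (sum_n_m_ext _ (coef u)); [trivial |].
intros k; rewrite emb_1; apply mult_one_r.
Qed.

Section Ordered.

Context (sigma tau : nat -> nat).
Context (tau_sigma : forall i, tau (sigma i) = i).
Context (sigma_tau : forall k, sigma (tau k) = k).
Context (stage : nat -> nat).
Context (stage_half : forall j,
  block_sum I j (fun k => if Nat.leb (tau k) (stage j) then 1 else 0) = INR (half j)).

(** Scaled so that a vector of constant modulus [height j] on the block [j] has
    norm [2 ^ - j] there. *)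
Definition height (j : nat) : R := (/ 2) ^ j / sqrt (INR (size I j)).

(** Positive on the half of each block that the ordering visits first, negative
    on the other half, so that the sums on blocks vanish. *)
Definition balanced (k : nat) : R :=
  if Nat.leb (tau k) (stage (block I k)) then height (block I k)
  else - height (block I k).

Lemma size_height_sq (j : nat) : INR (size I j) * height j ^ 2 = (/ 4) ^ j.
Proof.
unfold height; assert (h := size_pos I j).
replace ((/ 2) ^ j / sqrt (INR (size I j))) with ((/ 2) ^ j * / sqrt (INR (size I j)))
  by reflexivity.
rewrite Rpow_mult_distr, (pow_inv (sqrt (INR (size I j)))), pow2_sqrt by lra.
replace (/ 4) with (/ 2 * / 2) by field; rewrite Rpow_mult_distr.
replace (((/ 2) ^ j) ^ 2) with ((/ 2) ^ j * (/ 2) ^ j) by ring; field; lra.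
Qed.

Lemma balanced_sq (k : nat) : balanced k ^ 2 = height (block I k) ^ 2.
Proof. unfold balanced; destruct (Nat.leb _ _); ring. Qed.

Lemma balanced_block_sum (j : nat) : block_sum I j balanced = 0.
Proof.
rewrite (block_sum_ext I j _ (fun k => - height j +
  (if Nat.leb (tau k) (stage j) then 1 else 0) * (2 * height j))).
  rewrite block_sum_affine_R, block_sum_const, stage_half, size_half, mult_INR.
  simpl (INR 2); as_reals; ring.
intros k hk; unfold balanced; rewrite hk; destruct (Nat.leb _ _); as_reals; ring.
Qed.

Lemma balanced_summable : ex_series (fun k => abs (iota (balanced k)) ^ 2).
Proof.
apply (ex_series_of_block_sums I _ (fun j => (/ 4) ^ j)).
- intros k; apply pow2_ge_0.
- intros j; right.
  rewrite (block_sum_ext I j _ (fun _ => height j ^ 2)).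
    now rewrite block_sum_const, size_height_sq.
  intros k hk; now rewrite abs_emb_sq, balanced_sq, hk.
- apply ex_series_geom; rewrite Rabs_pos_eq; lra.
Qed.

Definition hump : ell2 K := Ell2 (fun k => iota (balanced k)) balanced_summable.

Lemma codilated_hump (n : nat) : codilated iota I t n hump = iota (balanced n).
Proof.
rewrite codilated_block_sum.
replace (block_sum I (block I n) (coef hump)) with (zero : K).
  exact (eq_trans (f_equal (plus (iota (balanced n))) (mult_zero_l _)) (plus_zero_r _)).
rewrite <- (emb_0 iota), <- (balanced_block_sum (block I n)); apply emb_block_sum.
Qed.

Definition partial_sum (n : nat) : ell2 K :=
  sum_n (fun i => scal (codilated iota I t (sigma i) hump)
    (dilated iota I t (sigma i))) n.

(** At the stage of the block [j], the visited half of the block is exactly the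
    positive one. The contributions to the block sum are no longer compensated,
    and each is multiplied by [t j]. *)
Lemma partial_sum_block_sum (j : nat) :
  block_sum I j (coef (partial_sum (stage j))) = iota (INR (half j) * (height j * t j)).
Proof.
transitivity (sum_n (fun i =>
    iota ((if Nat.eqb (block I (sigma i)) j then 1 else 0) * (height j * t j)))
  (stage j)).
  transitivity (block_sum I j (fun k => sum_n (fun i => mult (iota (balanced (sigma i)))
      (coef (dilated iota I t (sigma i)) k)) (stage j))).
    apply block_sum_ext; intros k _; unfold partial_sum, sum_n.
    refine (eq_trans (coef_sum _ _ _ k) _); apply sum_n_m_ext; intros i.
    now rewrite codilated_hump.
  rewrite <- block_sum_switch.
  apply sum_n_m_ext_loc; intros i hi.
  unfold block_sum; rewrite sum_n_m_mult_l.
  refine (eq_trans (f_equal (mult _) (block_sum_dilated iota I t j (sigma i))) _).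
  rewrite <- emb_mult; f_equal.
  destruct (Nat.eqb_spec (block I (sigma i)) j) as [h|h]; [| ring].
  unfold balanced; rewrite tau_sigma, h.
  rewrite (proj2 (Nat.leb_le i (stage j))) by lia; ring.
rewrite <- stage_half, <- (block_count_switch I sigma tau tau_sigma sigma_tau).
unfold sum_n; rewrite <- (sum_n_m_mult_r (K := R_Ring)); symmetry.
apply (sum_n_m_morph (G := R_AbelianMonoid) iota); [apply emb_0 | apply emb_plus].
Qed.

(** A block sum is at most [sqrt N] times the norm, where [N] is the size of the
    block, and here it equals [N / 2 * height j * t j]. *)
Lemma norm_partial_sum_ge (j : nat) : (/ 2) ^ j * t j / 2 <=
  norm (partial_sum (stage j)).
Proof.
assert (hs := size_pos I j); assert (hq := sqrt_lt_R0 _ hs).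
apply Rmult_le_reg_r with (1 := hq).
apply Rle_trans with (2 := abs_block_sum_le j _).
rewrite partial_sum_block_sum, abs_emb; apply Rle_trans with (2 := Rle_abs _).
replace (INR (half j)) with (sqrt (INR (size I j)) * sqrt (INR (size I j)) / 2).
  unfold height; right; field; lra.
rewrite sqrt_sqrt, size_half, mult_INR by lra; simpl (INR 2); field.
Qed.

End Ordered.

(** Equivalence with a Schauder basis would make the biorthogonal expansion of
    the hump converge, in the given order, so its partial sums would be bounded. *)
Lemma dilated_permutation_not_schauder :
  (forall M, exists j, M < (/ 2) ^ j * t j) ->
  forall sigma, Bijective sigma ->
    ~ exists y : nat -> ell2 K,
        schauder_basis y /\ equivalent_systems (fun n => dilated iota I t (sigma n)) y.
Proof.
intros htop sigma (tau & htau & hsigma) (y & hy & heq).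
assert (hstage : exists stage, forall j,
    block_sum I j (fun k => if Nat.leb (tau k) (stage j) then 1 else 0) = INR (half j)).
  apply (functional_choice (fun j n =>
    block_sum I j (fun k => if Nat.leb (tau k) n then 1 else 0) = INR (half j))).
  intros j; apply (block_initial_part I sigma tau htau hsigma).
  assert (h := first_lt I j); assert (h' := size_half j); unfold size in *; lia.
destruct hstage as [stage hstage].
set (u := hump tau stage).
assert (hu : in_closed_span (fun n => dilated iota I t (sigma n)) u).
  apply (fundamental_of_span (X := ell2_NormedModule K) (dilated iota I t)).
    intros n; rewrite <- (hsigma n).
    exact (in_span_term (X := ell2_NormedModule K)
      (fun n => dilated iota I t (sigma n)) (tau n)).
  now apply dilated_fundamental.
destruct (equivalent_schauder_expansion (X := ell2_NormedModule K)
  (Y := ell2_NormedModule K) _ y hy heq u hu) as [a ha].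
assert (hbi : biorthogonal (X := ell2_NormedModule K)
    (fun n => dilated iota I t (sigma n))
    (fun n => codilated iota I t (sigma n))).
  destruct (dilated_biorthogonal iota I t t_ge_1) as [hf hd].
  split; [intros n; apply hf |]; intros n m; rewrite hd.
  destruct (Nat.eqb_spec n m) as [->|hnm]; [now rewrite Nat.eqb_refl |].
  rewrite (proj2 (Nat.eqb_neq (sigma n) (sigma m))); trivial.
  intros e; apply hnm; now rewrite <- (htau n), e, htau.
assert (hcoef := biorthogonal_coefficients (X := ell2_NormedModule K) _ _ _ _ hbi ha).
destruct (filterlim_bounded (V := ell2_NormedModule K) _ (ex_intro _ u ha)) as [M hM].
destruct (htop (2 * M)) as [j hj].
specialize (hM (stage j)).
assert (hge := norm_partial_sum_ge sigma tau htau hsigma stage hstage j).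
rewrite (sum_n_ext _ (fun i => scal (codilated iota I t (sigma i) u)
  (dilated iota I t (sigma i)))) in hM by (intros i; now rewrite hcoef).
apply (Rle_not_lt _ _ (Rle_trans _ _ _ hge hM)); lra.
Qed.

End NoBasis.

(** * Choice of the blocks *)

Lemma positive_lower_bound (eps : nat -> R) (n0 : nat) :
  (forall n, 0 < eps n) ->
  exists d, 0 < d /\ forall n, (n < n0)%nat -> d <= eps n.
Proof.
intros h; induction n0 as [|n0 (d & hd & IH)].
  exists 1; split; [lra | intros n hn; lia].
exists (Rmin d (eps n0)); split; [now apply Rmin_pos |]; intros n hn.
destruct (Nat.eq_dec n n0) as [->|hne]; [apply Rmin_r |].
apply Rle_trans with (1 := Rmin_l _ _); apply IH; lia.
Qed.

(** A block at least as long as everything before it has a size comparable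
    to its largest index, so [T / size] is below [eps n] for the large [n];
    the finitely many remaining terms are bounded below and only require a
    longer block. *)
Lemma large_block_exists (eps : nat -> R) :
  (forall n, 0 < eps n) ->
  is_lim_seq (fun n => INR (S n) * eps n) p_infty ->
  forall (T : R) (s : nat), exists m, (0 < m)%nat /\
    forall n, (n < s + 2 * m)%nat -> T <= INR (2 * m) * eps n.
Proof.
intros heps hlim T s.
destruct (proj2 (is_lim_seq_spec _ _) hlim (2 * T)) as [n0 hn0].
destruct (positive_lower_bound eps n0 heps) as (d & hd & hle).
destruct (INR_unbounded (Rmax 0 (T / d))) as [m0 hm0].
exists (S (m0 + s)); split; [lia |]; intros n hn.
assert (hen := heps n).
destruct (Nat.lt_ge_cases n n0) as [h|h].
  specialize (hle n h).
  assert (hT : T <= INR m0 * d).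
    replace T with (T / d * d) by (field; lra).
    apply Rmult_le_compat_r; [lra |].
    assert (h' := Rmax_r 0 (T / d)); lra.
  apply Rle_trans with (1 := hT); apply Rmult_le_compat; try lra.
    apply pos_INR.
  apply le_INR; lia.
(* In this case n + 1 is at most twice the length of the block. *)
specialize (hn0 n h); simpl in hn0.
change (match n with O => 1 | S _ => INR n + 1 end) with (INR (S n)) in hn0.
assert (hS : INR (S n) <= 2 * INR (2 * S (m0 + s))).
  change 2 with (INR 2) at 1; rewrite <- mult_INR; apply le_INR; lia.
assert (INR (S n) * eps n <= 2 * INR (2 * S (m0 + s)) * eps n)
  by (apply Rmult_le_compat_r; lra).
lra.
Qed.

Definition R_embedding : real_embedding R_AbsRing :=
  RealEmbedding R_AbsRing (fun r => r) (fun _ _ => eq_refl) (fun _ _ => eq_refl)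
    eq_refl (fun _ => eq_refl).

Definition C_embedding : real_embedding C_AbsRing :=
  RealEmbedding C_AbsRing RtoC RtoC_plus RtoC_mult eq_refl Cmod_R.

(** With factors [4 ^ j] on the block [j] and humps of norm [2 ^ - j], the lower
    bound for the partial sums is [2 ^ j / 2], while the hump has finite norm. *)
Lemma exists_bounded_M_basis_without_schauder_ordering {K : AbsRing}
    (iota : real_embedding K) (eps : nat -> R) :
  (forall n, 0 < eps n) ->
  is_lim_seq (fun n => INR (S n) * eps n) p_infty ->
  exists (x : nat -> ell2 K) (xs : nat -> ell2 K -> K),
    M_basis x xs /\
    bounded_system eps x xs /\
    (forall sigma : nat -> nat, Bijective sigma ->
       ~ exists y : nat -> ell2 K,
           schauder_basis y /\ equivalent_systems (fun n => x (sigma n)) y).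
Proof.
intros heps hlim.
set (t := fun j => 4 ^ j).
assert (ht : forall j, 1 <= t j) by (intros j; apply pow_R1_Rle; lra).
destruct (functional_choice (fun (p : nat * nat) m => (0 < m)%nat /\
    forall n, (n < snd p + 2 * m)%nat -> t (fst p) ^ 2 <= INR (2 * m) * eps n))
  as [m hm].
  intros [j s]; apply (large_block_exists eps heps hlim).
set (start := fix start j :=
  match j with O => O | S i => (start i + 2 * m (i, start i))%nat end).
assert (hstart : forall j, (start j < start (S j))%nat).
  intros j; destruct (hm (j, start j)) as [h _]; simpl start; lia.
set (I := Intervals start eq_refl hstart).
assert (hsize : forall j, size I j = (2 * m (j, start j))%nat).
  intros j; unfold size; simpl first; lia.
exists (dilated iota I t), (codilated iota I t); split; [now apply dilated_M_basis |].
split.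
  apply dilated_bounded; trivial; intros n; rewrite hsize.
  apply (hm (block I n, start (block I n))); simpl snd.
  assert (h := in_own_block I n); unfold last in h; simpl first in h.
  assert (h' := hstart (block I n)); simpl start in h'; lia.
intros sigma hsigma.
apply (dilated_permutation_not_schauder iota I t ht (fun j => m (j, start j)) hsize);
  trivial.
intros M; destruct (Pow_x_infinity 2) with (b := M + 1) as [N hN].
  rewrite Rabs_pos_eq; lra.
exists N; unfold t; rewrite <- Rpow_mult_distr; replace (/ 2 * 4) with 2 by field.
specialize (hN N (Nat.le_refl N)).
rewrite Rabs_pos_eq in hN by (apply pow_le; lra); lra.
Qed.

(* Sequences are indexed from 0: eps n, x n, xs n are the terms of index n + 1. *)
Theorem theorem1p3 (K : AbsRing) (hK : K = R_AbsRing \/ K = C_AbsRing)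
  (eps : nat -> R) (eps_pos : forall n, (0 < eps n)%R)
  (eps_lim : is_lim_seq (fun n => (INR (S n) * eps n)%R) p_infty) :
  exists (x : nat -> ell2 K) (xs : nat -> ell2 K -> K),
    M_basis x xs /\
    bounded_system eps x xs /\
    (forall sigma : nat -> nat, Bijective sigma ->
       ~ exists y : nat -> ell2 K,
           schauder_basis y /\ equivalent_systems (fun n => x (sigma n)) y).
Proof.
destruct hK as [-> | ->].
- exact (exists_bounded_M_basis_without_schauder_ordering
    R_embedding eps eps_pos eps_lim).
- exact (exists_bounded_M_basis_without_schauder_ordering
    C_embedding eps eps_pos eps_lim).
Qed.
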